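(* Let $n\ge1$ and $k$ be integers with $n/2-1<k\le n$, $G=\mathbb Z_2^n$, $q=2^n$. Then \[ \lambda^\pm(B_k)\le\frac{2k+2}{q(2k+2-n)},\qquad \lambda^\pm(A_k)\ge 1-\frac{n}{2k+2}. \]
   Context: Elements of $G=\mathbb Z_2^n$ are $0$-$1$ sequences of length $n$; the norm $\|x\|$ is the number of coordinates of $x$ equal to $1$. The ball is $B_k=\{x\in G:\|x\|\le k\}$ and the antiball is $A_k=\{x\in G:\|x\|>k\}\cup\{0\}$. A character of $G$ is a homomorphism $\gamma:G\to\{z\in\mathbb C:|z|=1\}$; $\hat G$ is the group of characters and $\mathbf 1$ the principal character. For $f:G\to\mathbb R$, $\hat f(\gamma)=\sum_{x\in G}\gamma(x)f(x)$. For a set $A\subset G$ with $A=-A$, $0\in A$, let $\mathcal S^\pm(A)$ be the set of $f:G\to\mathbb R$, not identically zero, with $f\le0$ on $G\setminus A$ and $f\ge0$ on $A$, and $\lambda^\pm(A)=\min\{f(0)/\hat f(\mathbf 1): f\in\mathcal S^\pm(A),\ \hat f(\gamma)\ge0\ \forall\gamma\in\hat G\}$. *)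

(* Defs.v *)
From mathcomp Require Import all_boot all_order all_algebra all_field.
From mathcomp Require Import all_classical all_reals all_analysis.
From mathcomp Require Import complex.

Set Implicit Arguments.
Unset Strict Implicit.
Unset Printing Implicit Defensive.

Import Order.TTheory GRing.Theory Num.Theory.
Import numFieldNormedType.Exports.

Local Open Scope classical_set_scope.
Local Open Scope complex_scope.
Local Open Scope ring_scope.

Definition is_character (R : realType) (G : finZmodType) (gamma : G -> R[i]) :=
  (forall x, `|gamma x| = 1) /\
  (forall x y, gamma (x + y) = gamma x * gamma y).

Definition principal (R : realType) (G : finZmodType) : G -> R[i] := fun=> 1.

Definition fourier (R : realType) (G : finZmodType)
    (f : G -> R) (gamma : G -> R[i]) : R[i] :=
  \sum_(x : G) gamma x * (f x)%:C.

Definition Spm (R : realType) (G : finZmodType) (A : {set G}) (f : G -> R) :=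
  [/\ exists x, f x != 0,
      forall x, x \notin A -> f x <= 0
    & forall x, x \in A -> 0 <= f x].

(* On R[i], [0 <= z] means that z is real and nonnegative. Functions with
   fourier f principal = 0 are excluded: their ratio f 0 / 0 is +oo (f 0 > 0 for
   every nonzero f with nonnegative Fourier transform), so they do not affect
   the minimum, whereas in Rocq x / 0 = 0. *)
Definition ratios (R : realType) (G : finZmodType) (A : {set G}) : set R :=
  [set r | exists f : G -> R,
    [/\ Spm A f,
        forall gamma, is_character gamma -> 0 <= fourier f gamma,
        fourier f (@principal R G) != 0
      & r%:C = (f 0)%:C / fourier f (@principal R G)]].

(* The infimum is a minimum whenever 0 \in A: see lambda_pm_min below. *)
Definition lambda_pm (R : realType) (G : finZmodType) (A : {set G}) : R :=
  inf (ratios A).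

Definition hnorm (n : nat) (x : 'rV['F_2]_n) : nat :=
  #|[set i : 'I_n | x ord0 i == 1]%SET|.

Definition hball (n k : nat) : {set 'rV['F_2]_n} :=
  [set x | hnorm x <= k]%N%SET.

Definition antiball (n k : nat) : {set 'rV['F_2]_n} :=
  ([set x | k < hnorm x]%N :|: [set 0])%SET.

Section Minimum.
Variables (R : realType) (n : nat).
Local Notation G := 'rV['F_2]_n.

Let chi (y x : G) : R[i] :=
  \prod_(i < n) (-1) ^+ (y ord0 i * x ord0 i : 'F_2)%R.

Let signF2D (a b : 'F_2) :
  (-1) ^+ (a + b : 'F_2)%R = (-1) ^+ a * (-1) ^+ b :> R[i].
Proof.
case: a b => [[|[|//]] ?] [[|[|//]] ?];
  rewrite /= ?expr0 ?expr1 ?mulr1 ?mul1r //.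
by rewrite mulrNN mulr1.
Qed.

Let chiD y x z : chi y (x + z) = chi y x * chi y z.
Proof.
by rewrite -big_split; apply: eq_bigr => i _; rewrite mxE mulrDr signF2D.
Qed.

Let norm_chi y x : `|chi y x| = 1.
Proof. by rewrite normr_prod big1 // => i _; rewrite normrX normrN1 expr1n. Qed.

Let chi_char y : is_character (chi y).
Proof. by split; [exact: norm_chi | exact: chiD]. Qed.

Let chiC y x : chi y x = chi x y.
Proof. by apply: eq_bigr => i _; rewrite mulrC. Qed.

Let sum_chi x : \sum_y chi y x = if x == 0 then (2 ^+ n : R[i]) else 0.
Proof.
case: eqP => [->|/eqP].
  rewrite (eq_bigr (fun=> 1)) => [|y _]; last first.
    by rewrite /chi big1 // => i _; rewrite mxE mulr0.
  by rewrite sumr_const card_mx card_Fp // mul1n natrX.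
rewrite -subr_eq0 subr0 => x0.
have [i xi] : exists i, x ord0 i != 0.
  apply/existsP; apply: contraNT x0 => /existsPn x0.
  by apply/eqP/rowP => i; rewrite mxE; apply/eqP; rewrite -[_ == _]negbK x0.
pose e : G := delta_mx ord0 i.
have xi1 : x ord0 i = 1.
  by move: xi; case: (x ord0 i) => [[|[|//]] ?] // _; apply/val_inj.
have ch : chi e x = -1.
  rewrite /chi (bigD1 i) // big1 => [|j ji]; rewrite mxE ?eqxx.
    by rewrite xi1 !mulr1 /= mulr1 expr1.
  by rewrite (negPf ji) andbF mul0r.
have E : \sum_y chi y x = - \sum_y chi y x.
  rewrite {1}(reindex_inj (addrI e)) /= -sumrN; apply: eq_bigr => y _.
  by rewrite chiC chiD -chiC ch mulN1r chiC.
by apply/eqP; move/eqP: E; rewrite -subr_eq0 opprK -mulr2n mulrn_eq0.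
Qed.

Let inversion (f : G -> R) z :
  \sum_y fourier f (chi y) * chi y z = (2 ^+ n * f z)%:C.
Proof.
rewrite /fourier; under eq_bigr do rewrite mulr_suml.
rewrite exchange_big /= (bigD1 z) //= [X in _ + X]big1 => [|x xz].
  rewrite addr0; under eq_bigr do rewrite mulrAC -chiD.
  rewrite -mulr_suml sum_chi.
  have -> : z + z = 0.
    by apply/rowP => i; rewrite !mxE; apply: (addrr_pchar2 (pchar_Fp _)).
  by rewrite eqxx rmorphM rmorphXn rmorph_nat.
under eq_bigr do rewrite mulrAC -chiD.
rewrite -mulr_suml sum_chi ifF ?mul0r //; apply: contra_neqF xz => /eqP.
move=> xz; apply/rowP => i; move/rowP: xz => /(_ i); rewrite !mxE.
move/eqP; rewrite addr_eq0 => /eqP ->.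
by apply: (oppr_pchar2 (pchar_Fp _)).
Qed.

Let posdef (f : G -> R) :=
  forall gamma, is_character gamma -> 0 <= fourier f gamma.

Let posdef_le f z : posdef f -> `|f z| <= f 0.
Proof.
move=> fp.
have: `|(2 ^+ n * f z)%:C : R[i]| <= (2 ^+ n * f 0)%:C.
  rewrite -!inversion; apply: le_trans (ler_norm_sum _ _ _) _.
  apply: ler_sum => y _; rewrite normrM norm_chi mulr1 ger0_norm ?fp //.
  by rewrite /chi big1 ?mulr1 // => i _; rewrite mxE mulr0.
rewrite normc_def /= expr0n addr0 sqrtr_sqr lecR normrM gtr0_norm ?exprn_gt0 //.
by rewrite ler_pM2l // exprn_gt0.
Qed.

Let fourier1 f : fourier f (@principal R G) = (\sum_x f x)%:C.
Proof. by rewrite rmorph_sum; apply: eq_bigr => x _; rewrite mul1r. Qed.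

Lemma lambda_pm_min (A : {set G}) :
  0 \in A -> ratios A (lambda_pm R A) /\ lbound (ratios A) (lambda_pm R A).
Proof.
move=> A0.
pose F (v : 'rV[R]_#|G|) (x : G) : R := v ord0 (enum_rank x).
have Fc x : continuous (F ^~ x) by move=> v; exact: coord_continuous.
have sumc (c : G -> R) : continuous (fun v => \sum_x c x * F v x).
  apply: (@continuous_big R G +%R 0 predT) => [|x _ v].
    exact: (@add_continuous R^o).
  exact: (continuousM (@cst_continuous _ _ (c x) v) (Fc x v)).
pose K : set 'rV[R]_#|G| := [set v | F v 0 = 1] `&`
  ((\bigcap_(x in [set x | x \notin A]) [set v | F v x <= 0]) `&`
   ((\bigcap_(x in [set x | x \in A]) [set v | 0 <= F v x]) `&`
    ((\bigcap_(g in [set g : G -> R[i] | is_character g])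
       [set v | \sum_x complex.Im (g x) * F v x = 0]) `&`
     (\bigcap_(g in [set g : G -> R[i] | is_character g])
       [set v | 0 <= \sum_x complex.Re (g x) * F v x])))).
have posF v : ((\bigcap_(g in [set g : G -> R[i] | is_character g])
       [set v | \sum_x complex.Im (g x) * F v x = 0]) `&`
     (\bigcap_(g in [set g : G -> R[i] | is_character g])
       [set v | 0 <= \sum_x complex.Re (g x) * F v x])) v <-> posdef (F v).
  have E g : fourier (F v) g =
     (\sum_x complex.Re (g x) * F v x) +i* (\sum_x complex.Im (g x) * F v x).
    rewrite /fourier; elim/big_rec3: _ => // x a b c _ ->.
    by case: (g x) => p q /=; rewrite /real_complex_def; simpc.
  split=> [[I P] g gc|P].
    by rewrite E lecE /= I // eqxx; apply: P.
  by split=> g gc /=; have := P g gc; rewrite E lecE /= => /andP[/eqP].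
have Kclosed : closed K.
  have pc (h : 'rV[R]_#|G| -> R) D :
      continuous h -> closed D -> closed (h @^-1` D).
    by move=> hc; apply: preimage_closed => v _; exact: hc.
  apply: closedI; first exact: (pc _ _ (Fc 0) (@closed_eq R 1)).
  apply: closedI.
    by apply: closed_bigI => x _; exact: (pc _ _ (Fc x) (@closed_le R 0)).
  apply: closedI.
    by apply: closed_bigI => x _; exact: (pc _ _ (Fc x) (@closed_ge R 0)).
  apply: closedI; apply: closed_bigI => g _.
    exact: (pc _ _ (sumc (fun x => complex.Im (g x))) (@closed_eq R 0)).
  exact: (pc _ _ (sumc (fun x => complex.Re (g x))) (@closed_ge R 0)).
have Kbounded : bounded_set K.
  exists 1; split=> // M M1 v [v0 [_ [_ /posF vp]]].
  apply: le_trans (ltW M1); rewrite [leLHS]/Num.norm /= mx_normrE.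
  apply/bigmax_leP; split=> // -[a i] _ /=; rewrite (ord1 a).
  by have := posdef_le (enum_val i) vp; rewrite v0 /F enum_valK.
pose V (f : G -> R) : 'rV[R]_#|G| := \row_i f (enum_val i).
have FV f : F (V f) = f.
  by apply/funext => x; rewrite /F mxE enum_rankK.
pose dl (x : G) : R := (x == 0)%:R.
have sumdl (h : G -> R[i]) : \sum_x h x * (dl x)%:C = h 0.
  rewrite (bigD1 0) //= /dl eqxx mulr1 big1 ?addr0 // => x /negPf ->.
  by rewrite mulr0.
have Kdl : K (V dl).
  rewrite /K /= FV; split; first by rewrite /= /dl eqxx.
  split.
    move=> x /= xA; rewrite FV /dl.
    by case: (eqVneq x 0) xA => [->|]; rewrite ?A0.
  split; first by move=> x /= _; rewrite FV ler0n.
  apply/posF; rewrite FV => g [g1 gD].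
  rewrite /fourier sumdl.
  have : g 0 * g 0 = g 0 * 1 by rewrite -gD addr0 mulr1.
  have g0 : g 0 != 0 by rewrite -normr_eq0 g1 oner_eq0.
  by move/(mulfI g0) ->.
have := @compact_EVT_max _ R (fun v => \sum_x 1 * F v x) K.
case.
- by exists (V dl).
- exact: bounded_closed_compact.
- exact/continuous_subspaceT/sumc.
move=> v; rewrite inE => Kv vmax.
have s1 : 1 <= \sum_x F v x.
  have := vmax (V dl); rewrite inE => /(_ Kdl).
  under eq_bigr do rewrite mul1r; under [leRHS]eq_bigr do rewrite mul1r.
  apply: le_trans; rewrite FV (bigD1 0) //= /dl eqxx lerDl.
  by apply: sumr_ge0 => x _; rewrite ler0n.
have s0 : 0 < \sum_x F v x by apply: lt_le_trans s1.
have Rv : ratios A ((\sum_x F v x)^-1).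
  exists (F v); case: Kv => v0 [vA [vA' /posF vp]]; split=> //.
  - by split; [exists 0; rewrite v0 oner_eq0 | exact: vA | exact: vA'].
  - by rewrite fourier1 eq_complex /= eqxx andbT gt_eqF.
  - by rewrite fourier1 v0 -fmorphV mul1r.
have lbv : lbound (ratios A) ((\sum_x F v x)^-1).
  move=> r [f [[[z fz] fn fp] fpos fne]].
  have f0 : 0 < f 0 by apply: lt_le_trans (posdef_le z fpos); rewrite normr_gt0.
  have S0 : 0 < \sum_x f x.
    have : 0 <= fourier f (@principal R G).
      by apply: fpos; split=> *; rewrite /principal ?normr1 ?mulr1.
    move: fne; rewrite fourier1 ler0c lt0r => + ->; rewrite andbT.
    by apply: contra_neq => ->.
  rewrite fourier1 -fmorphV -rmorphM => /complexI ->.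
  have := vmax (V (fun x => f x / f 0)); rewrite inE.
  have scale (g : G -> R[i]) :
      fourier (fun x => f x / f 0) g = fourier f g * ((f 0)^-1)%:C.
    by rewrite mulr_suml; apply: eq_bigr => x _; rewrite rmorphM mulrA.
  rewrite -[f 0 / _]invf_div lef_pV2 ?posrE ?divr_gt0 // => vle.
  have {vle} := vle _; under eq_bigr do rewrite mul1r.
  under [in leRHS]eq_bigr do rewrite mul1r.
  rewrite FV -mulr_suml; apply; split; first by rewrite /= FV divff ?gt_eqF.
  split; first by move=> x /= xA; rewrite FV pmulr_lle0 ?invr_gt0 // fn.
  split; first by move=> x /= xA; rewrite FV pmulr_lge0 ?invr_gt0 // fp.
  apply/posF; rewrite FV => g gc; rewrite scale mulr_ge0 ?fpos //.
  by rewrite ler0c invr_ge0 ltW.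
suff -> : lambda_pm R A = (\sum_x F v x)^-1 by split.
apply/eqP; rewrite eq_le; apply/andP; split.
  apply: ge_inf => //; by exists (\sum_x F v x)^-1.
by apply: lb_le_inf => //; exists (\sum_x F v x)^-1.
Qed.
End Minimum.

(* Main.v *)
Require Import Defs.
From mathcomp Require Import all_boot all_order all_algebra all_field.
From mathcomp Require Import all_classical all_reals all_analysis.
From mathcomp Require Import complex ring lra.

(** The witness is [g x = 2 (k + 1 - |x|) = (2k + 2 - n) + sum_i (-1)^(x_i)].
    It is nonnegative exactly where [|x| <= k + 1], and its expansion shows that
    it is a combination, with nonnegative coefficients, of the principal
    character and of the coordinate characters. This gives the bound for balls
    at once. For [h] admissible for the antiball, [g x * h x <= 0] off the
    origin, so [(2k + 2 - n) h^(1) <= sum_x g x * h x <= g 0 * h 0]. *)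

Import Order.TTheory GRing.Theory Num.Theory.
Local Open Scope complex_scope.
Local Open Scope ring_scope.

Set Implicit Arguments.
Unset Strict Implicit.

Section Characters.
Variables (R : realType) (G : finZmodType).
Implicit Types gamma delta : G -> R[i].

Lemma is_character_principal : is_character (@principal R G).
Proof. by split=> *; rewrite /principal ?normr1 ?mulr1. Qed.

Lemma is_characterM gamma delta : is_character gamma -> is_character delta ->
  is_character (fun x => gamma x * delta x).
Proof.
move=> [g1 gD] [d1 dD]; split=> [x|x y]; first by rewrite normrM g1 d1 mulr1.
by rewrite gD dD mulrACA.
Qed.

(** Translating the summation variable by [a] multiplies the sum by [gamma a], so [gamma a - 1]
    annihilates it. *)
Lemma sum_character_eq0 gamma a :
  is_character gamma -> gamma a != 1 -> \sum_x gamma x = 0.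
Proof.
move=> [_ gD] ga; apply/eqP; have: (gamma a - 1) * \sum_x gamma x = 0.
  rewrite mulrBl mul1r [X in _ - X](reindex_inj (addrI a)) /= mulr_sumr.
  by under [X in _ - X]eq_bigr do rewrite gD; rewrite subrr.
by move/eqP; rewrite mulf_eq0 subr_eq0 (negPf ga).
Qed.

Lemma sum_character_ge0 gamma : is_character gamma -> 0 <= \sum_x gamma x.
Proof.
move=> gc; have [/forallP g1|/forallPn[a ga]] := boolP [forall x, gamma x == 1].
  by apply: sumr_ge0 => x _; rewrite (eqP (g1 x)).
by rewrite (sum_character_eq0 gc ga).
Qed.

End Characters.

Section Cube.
Variables (R : realType) (n : nat).
Local Notation G := 'rV['F_2]_n.

(** The character [(-1)^(x_i)], kept real-valued because the witness built from it must be real. *)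
Definition coord_sign (i : 'I_n) (x : G) : R :=
  if x ord0 i == 1 then -1 else 1.

Lemma is_character_coord_sign i :
  is_character (fun x => (coord_sign i x)%:C).
Proof.
split=> [x|x y]; rewrite /coord_sign.
  by case: ifP => _; rewrite ?rmorphN1 ?rmorph1 ?normrN1 ?normr1.
rewrite mxE; case: (x ord0 i) (y ord0 i) => [[|[|//]] ?] [[|[|//]] ?] /=;
  by rewrite -rmorphM ?mulrNN ?mulr1 ?mul1r.
Qed.

Lemma coord_sign_neq1 i : (coord_sign i (delta_mx ord0 i))%:C != 1 :> R[i].
Proof.
rewrite /coord_sign mxE !eqxx /= eq_complex /= eqxx andbT.
by apply/eqP => ?; lra.
Qed.

Lemma sum_coord_sign (x : G) :
  \sum_i coord_sign i x = n%:R - 2 * (hnorm x)%:R.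
Proof.
have -> : (hnorm x)%:R = \sum_i (x ord0 i == 1)%:R :> R.
  rewrite /hnorm -sum1_card natr_sum big_mkcond /=.
  by apply: eq_bigr => i _; rewrite inE; case: ifP.
rewrite mulr_sumr -[n in n%:R]card_ord -sumr_const -sumrB.
by apply: eq_bigr => i _; rewrite /coord_sign; case: ifP => _ /=; ring.
Qed.

Lemma hnorm0 : hnorm (0 : G) = 0%N.
Proof. by apply: eq_card0 => i; rewrite !inE mxE. Qed.

Lemma fourier_principal (f : G -> R) :
  fourier f (@principal R G) = (\sum_x f x)%:C.
Proof. by rewrite rmorph_sum; apply: eq_bigr => x _; rewrite mul1r. Qed.

Definition ball_witness (k : nat) (x : G) : R :=
  2 * k%:R + 2 - 2 * (hnorm x)%:R.

Lemma ball_witness_ge0 k x : (hnorm x <= k)%N -> 0 <= ball_witness k x.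
Proof. by rewrite /ball_witness -(ler_nat R) => ?; lra. Qed.

(** The sign change falls at norm [k + 1], where the witness vanishes; this is why its constant is
    [2k + 2]. *)
Lemma ball_witness_le0 k x : (k < hnorm x)%N -> ball_witness k x <= 0.
Proof. by rewrite /ball_witness -(ler_nat R) -natr1 => ?; lra. Qed.

Lemma ball_witness0 k : ball_witness k 0 = 2 * k%:R + 2.
Proof. by rewrite /ball_witness hnorm0 mulr0 subr0. Qed.

Lemma ball_witnessE k x :
  ball_witness k x = (2 * k%:R + 2 - n%:R) + \sum_i coord_sign i x.
Proof. by rewrite sum_coord_sign /ball_witness; ring. Qed.

(** [F] is left arbitrary to serve twice: a character gives the transform of the witness, an
    admissible function its pairing with the witness. *)
Lemma sum_ball_witness k (F : G -> R[i]) :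
  \sum_x F x * (ball_witness k x)%:C =
  (2 * k%:R + 2 - n%:R)%:C * \sum_x F x +
  \sum_i \sum_x F x * (coord_sign i x)%:C.
Proof.
rewrite exchange_big mulr_sumr -big_split; apply: eq_bigr => x _ /=.
by rewrite ball_witnessE rmorphD rmorph_sum mulrDr mulr_sumr mulrC.
Qed.

(** Each term of the expansion is a nonnegative multiple of the sum of a character, since characters
    are closed under products. *)
Lemma fourier_ball_witness_ge0 k (gamma : G -> R[i]) :
  0 <= 2 * k%:R + 2 - n%:R :> R -> is_character gamma ->
  0 <= fourier (ball_witness k) gamma.
Proof.
move=> k0 gc; rewrite /fourier sum_ball_witness addr_ge0 //.
  by rewrite mulr_ge0 ?ler0c ?sum_character_ge0.
apply: sumr_ge0 => i _; apply: sum_character_ge0.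
exact: is_characterM gc (is_character_coord_sign i).
Qed.

Lemma fourier_ball_witness_principal k :
  fourier (ball_witness k) (@principal R G) =
  (2 ^+ n * (2 * k%:R + 2 - n%:R))%:C.
Proof.
(* Coordinate characters are nontrivial and sum to zero, so only the constant term survives. *)
rewrite /fourier sum_ball_witness [X in _ + X]big1 => [|i _]; last first.
  under eq_bigr do rewrite mul1r.
  exact: (sum_character_eq0 (is_character_coord_sign i) (coord_sign_neq1 i)).
rewrite addr0 sumr_const card_mx card_Fp // mul1n rmorphM mulrC.
by rewrite rmorphXn rmorph_nat natrX.
Qed.

Lemma lambda_pm_hball_le k : 0 < 2 * k%:R + 2 - n%:R :> R ->
  lambda_pm R (hball n k)
    <= (2 * k%:R + 2) / (2 ^+ n * (2 * k%:R + 2 - n%:R)).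
Proof.
move=> k0; have /(lambda_pm_min R)[_] : 0 \in hball n k by rewrite inE hnorm0.
apply; exists (ball_witness k); rewrite fourier_ball_witness_principal.
split=> [|gamma||].
- split=> [|x|x]; last by rewrite inE; exact: ball_witness_ge0.
    by exists 0; rewrite ball_witness0 gt_eqF // ltr_wpDl ?mulr_ge0.
  by rewrite inE -ltnNge; exact: ball_witness_le0.
- exact/fourier_ball_witness_ge0/ltW.
- by rewrite eq_complex /= eqxx andbT gt_eqF // mulr_gt0 ?exprn_gt0.
- by rewrite ball_witness0 rmorphM fmorphV.
Qed.

(** Off the origin, [h] and the witness have opposite signs both inside and outside the ball. *)
Lemma ball_witness_antiball_le0 k (h : G -> R) x :
  Spm (antiball n k) h -> x != 0 -> h x * ball_witness k x <= 0.
Proof.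
move=> [_ hn hp] x0; have [xk|xk] := leqP (hnorm x) k.
  rewrite mulr_le0_ge0 ?ball_witness_ge0 // hn //.
  by rewrite !inE negb_or -leqNgt xk.
by rewrite mulr_ge0_le0 ?ball_witness_le0 // hp // !inE xk.
Qed.

(** The terms dropped are the values of the transform of [h] at the coordinate characters. *)
Lemma sum_posdef_ball_witness_ge k (h : G -> R) :
  (forall gamma, is_character gamma -> 0 <= fourier h gamma) ->
  (2 * k%:R + 2 - n%:R) * \sum_x h x <= \sum_x h x * ball_witness k x.
Proof.
move=> hpos; rewrite -lecR [X in _ <= X]rmorph_sum /=.
under [X in _ <= X]eq_bigr do rewrite rmorphM.
rewrite sum_ball_witness rmorphM rmorph_sum lerDl; apply: sumr_ge0 => i _.
under eq_bigr do rewrite mulrC.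
exact: hpos (is_character_coord_sign i).
Qed.

Lemma lambda_pm_antiball_ge k :
  1 - n%:R / (2 * k%:R + 2) <= lambda_pm R (antiball n k).
Proof.
(* The minimum is attained, so it suffices to bound the ratio of an extremal [h]. *)
have /(lambda_pm_min R)[+ _] : 0 \in antiball n k by rewrite !inE eqxx orbT.
case=> h [hS hpos]; rewrite fourier_principal => hne.
rewrite -fmorphV -rmorphM => /complexI ->.
have S0 : 0 < \sum_x h x.
  have := hpos _ (is_character_principal R G).
  rewrite fourier_principal ler0c lt0r => ->; rewrite andbT.
  by apply: contra_neq hne => ->.
have k0 : 0 < 2 * k%:R + 2 :> R by rewrite ltr_wpDl ?mulr_ge0.
have -> : 1 - n%:R / (2 * k%:R + 2) = (2 * k%:R + 2 - n%:R) / (2 * k%:R + 2) :> R.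
  by rewrite mulrBl divff ?gt_eqF.
(* Clearing denominators leaves [(2k + 2 - n) * sum h <= h 0 * (2k + 2)]. *)
rewrite ler_pdivrMr // mulrAC ler_pdivlMr //.
apply: le_trans (sum_posdef_ball_witness_ge k hpos) _.
rewrite (bigD1 0) //= ball_witness0 gerDl; apply: sumr_le0 => x.
exact: ball_witness_antiball_le0.
Qed.

End Cube.

Unset Implicit Arguments.

Theorem theorem10p3 (R : realType) (n k : nat)
    (n_ge1 : (1 <= n)%N) (k_gt : n%:R / 2 - 1 < k%:R :> R) (k_le : (k <= n)%N) :
  lambda_pm R (hball n k)
    <= (2 * k%:R + 2) / (2 ^+ n * (2 * k%:R + 2 - n%:R)) /\
  1 - n%:R / (2 * k%:R + 2) <= lambda_pm R (antiball n k).
Proof.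
split; last exact: lambda_pm_antiball_ge.
(* Doubling [n / 2 - 1 < k] gives [0 < 2k + 2 - n]. *)
by apply: lambda_pm_hball_le; lra.
Qed.
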